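(* Let $\mathbb{F}_q$ be a finite field of characteristic two, let $\sigma\in\mathbb{F}_q$ have absolute trace $1$, and let $n>1$ be an integer. If $q\equiv 1\pmod 3$, then \[ |\mathcal{I}(x^3+\sigma x+\sigma,\,x^2+x+\sigma+1,\,n,\,q)|=\frac{1}{3n_3}\Bigl(I\bigl(n/(2n_3),q^{2n_3}\bigr)-I\bigl(n/(2n_3),1\bigr)\Bigr). \] If $q\equiv -1\pmod 3$, then \[ |\mathcal{I}(x^3+\sigma x+\sigma,\,x^2+x+\sigma+1,\,n,\,q)|=\frac{2}{3n_3}\Bigl(I\bigl(n/n_3,q^{n_3}\bigr)-I\bigl(n/n_3,-1\bigr)\Bigr). \]
   Context: The absolute trace of an element of $\mathbb{F}_q$, with $q$ a power of $2$, is its trace over the prime field $\mathbb{F}_2$. For coprime $g,h\in\mathbb{F}_q[x]$ and an integer $n>1$, $\mathcal{I}(g,h,n,q)$ denotes the set of monic irreducible polynomials $f\in\mathbb{F}_q[x]$ of degree $n$ such that $h(x)^n f\bigl(g(x)/h(x)\bigr)$ is irreducible in $\mathbb{F}_q[x]$. $n_3$ denotes the largest power of $3$ dividing $n$. For a positive integer $k$ and any integer $Q$ (not necessarily a prime power, possibly negative), $I(k,Q)=\frac1k\sum_{d\mid k}\mu(d)Q^{k/d}$, where $\mu$ is the Möbius function; $I(k,Q)=0$ by convention when $k$ is not a positive integer. *)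

(* Defs.v *)
From HB Require Import structures.
From mathcomp Require Import all_boot all_order all_fingroup all_algebra.
From mathcomp Require Import all_solvable all_field.

Set Implicit Arguments.
Unset Strict Implicit.
Unset Printing Implicit Defensive.

Import GRing.Theory Num.Theory.
Local Open Scope ring_scope.

(* [pPrimeCharType charFp] is F viewed as an extension of 'F_p, so that 1 is
   its prime subfield and the Galois group is that of F over 'F_p. *)
Definition abs_trace (F : finFieldType) (p : nat) (charFp : p \in [pchar F])
    (x : F) : F :=
  galTrace 1%VS {: pPrimeCharType charFp}%VS x.

(* The polynomial h^n f(g/h), for f of degree at most n. *)
Definition rat_transform (F : fieldType) (g h : {poly F}) (n : nat)
    (f : {poly F}) : {poly F} :=
  \sum_(i < n.+1) f`_i *: (g ^+ i * h ^+ (n - i)).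

Lemma rat_transformE (F : fieldType) (g h : {poly F}) (n : nat)
    (f : {poly F}) :
  h != 0 -> (size f <= n.+1)%N ->
  tofrac (rat_transform g h n f) =
    tofrac h ^+ n *
      (map_poly (@tofrac {poly F} \o polyC) f).[tofrac g / tofrac h].
Proof.
move=> h0 sf; have h0' : tofrac h != 0 by rewrite tofrac_eq0.
rewrite (@horner_coef_wide _ n.+1); last exact: leq_trans (size_poly _ _) sf.
rewrite rmorph_sum mulr_sumr; apply: eq_bigr => i _ /=.
rewrite coef_map_id0 /= ?raddf0 ?tofrac0 // -mul_polyC 2!rmorphM !rmorphXn.
have le_in : (i <= n)%N by rewrite -ltnS.
rewrite expr_div_n [RHS]mulrCA; congr (_ * _).
by rewrite mulrCA; congr (_ * _); rewrite expfB_cond // (negPf h0').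
Qed.

(* The bounded-size type [{poly_n.+1 F}] makes this set a finite set. *)
Definition irr_transform_set (F : finFieldType) (g h : {poly F}) (n : nat) :
    {set {poly_n.+1 F}} :=
  [set f : {poly_n.+1 F} |
     [&& polyn f \is monic, size (polyn f) == n.+1, irreducibleb (polyn f)
       & irreducibleb (rat_transform g h n (polyn f))]].

Definition mobius (d : nat) : int :=
  if (0 < d)%N && all (fun p => logn p d == 1%N) (primes d)
  then (-1) ^+ size (primes d) else 0.

Definition necklace (k : rat) (Q : int) : rat :=
  if (k \is a Num.nat) && (0 < k) then
    let m := Num.truncn k in
    m%:R^-1 * \sum_(d <- divisors m) (mobius d * Q ^+ (m %/ d))%:~R
  else 0.

(* Main.v *)
Require Import Defs.
From HB Require Import structures.
From mathcomp Require Import all_boot all_order all_fingroup all_algebra.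
From mathcomp Require Import all_solvable all_field.
From mathcomp Require Import zify ring.

Import GRing.Theory Num.Theory.
Local Open Scope ring_scope.

Set Implicit Arguments.
Unset Strict Implicit.
Unset Printing Implicit Defensive.

(** Let q be the cardinal of F, K an algebraic closure of F, and g / h the rational
    map of degree three under study. A monic irreducible f of degree n with root a
    has an irreducible transform exactly when the fibre of a under g / h has no
    point in the subfield of K with q^n elements: the fibre is the zero set of the
    cubic g - a h, on which Frobenius acts as a 3-cycle if it has no fixed point,
    so that its points then have degree 3 n over F (cubic_root_level,
    transform_irreducibleP).

    Call a point of the field with q^m elements bad at level m if its fibre has no
    point in that field. By the same 3-cycle argument, a point of level d is bad at
    level d e if and only if it is bad at level d and 3 does not divide e
    (empty_fibreM). A Moebius inversion over the divisors of n prime to 3 then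
    expresses the number of bad points of exact degree n, which is n times the
    desired cardinal, by the numbers of bad points at the levels n / d
    (card_irr_transform). All this holds for any coprime g and h with g monic of degree
    three and h of smaller degree.

    For the given map the bad points can be counted. Let t^2 + t = sigma. In
    characteristic two, g + t h = (X + t)^3 and g + (t + 1) h = (X + t + 1)^3, so
    the coordinate phi = (X + t) / (X + t + 1) turns g / h into the cube map. The
    trace condition says that t is not in F, hence Frobenius exchanges t and t + 1,
    which replaces phi by its inverse. Therefore phi maps the projective line over
    the field with q^m elements, without t and t + 1, onto the group of roots of
    unity of order N = q^m - (-1)^m, and the bad points are the noncubes of this
    group: two thirds of it if 3 divides N, none otherwise (count_empty_fibre). If
    q = 1 modulo 3, then 3 divides N for even m only; if q = -1 modulo 3, then 3
    always divides N. This is the difference between the two formulas. *)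

(** * Moebius sums *)

Lemma mobius_square p e : prime p -> (p %| e)%N -> mobius (p * e) = 0.
Proof.
move=> p_pr pe; rewrite /mobius; case: ifP => // /andP[pe0 /allP sqf].
have e0 : (0 < e)%N by move: pe0; rewrite muln_gt0 => /andP[].
have /sqf : p \in primes (p * e) by rewrite mem_primes p_pr pe0 dvdn_mulr.
rewrite lognM ?(prime_gt0 p_pr) // (logn_prime p p_pr) eqxx add1n eqSS -leqn0 leqNgt.
by rewrite logn_gt0 mem_primes p_pr e0 pe.
Qed.

Lemma mobius_primeM p e : prime p -> (0 < e)%N -> ~~ (p %| e)%N ->
  mobius (p * e) = - mobius e.
Proof.
move=> p_pr e0 npe; have p0 := prime_gt0 p_pr.
have perm : perm_eq (primes (p * e)) (p :: primes e).
  apply: uniq_perm; rewrite ?primes_uniq //=.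
    by rewrite primes_uniq mem_primes p_pr e0 (negPf npe).
  by move=> r; rewrite primesM // primes_prime // !inE.
rewrite /mobius muln_gt0 p0 e0 (perm_all _ perm) (perm_size perm) /=.
rewrite lognM // (logn_prime p p_pr) eqxx logn_coprime ?prime_coprime //= exprS mulN1r.
rewrite [all _ _](_ : _ = all (fun r => logn r e == 1%N) (primes e)).
  by case: ifP; rewrite ?oppr0.
apply: eq_in_all => r; rewrite mem_primes => /and3P[r_pr _ re].
rewrite lognM // (logn_prime r p_pr); case: (r =P p) => // rp.
by rewrite -rp re in npe.
Qed.

(** Multiplication by a prime divisor p of m matches the divisors prime to p
    with those that p divides once, and changes the sign of their terms. *)
Lemma sum_mobius m : (0 < m)%N ->
  \sum_(d <- divisors m) mobius d = (m == 1%N)%:R :> int.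
Proof.
move=> m0; case: eqP => [->|/eqP m1]; first by rewrite big_seq1.
have m_gt1 : (1 < m)%N by rewrite ltn_neqAle eq_sym m1.
set p := pdiv m; have p_pr : prime p by apply: pdiv_prime.
have p0 := prime_gt0 p_pr; have pm : (p %| m)%N by apply: pdiv_dvd.
rewrite (bigID (fun d => p %| d)%N) /= addrC; apply/eqP; rewrite addr_eq0; apply/eqP.
rewrite [in RHS](bigID (fun d => p %| d %/ p)%N) /= [X in - (X + _)]big1 ?add0r.
  rewrite -big_filter -[in RHS]big_filter -sumrN.
  have perm : perm_eq [seq d <- divisors m | (p %| d)%N && ~~ (p %| d %/ p)%N]
      (map (muln p) [seq e <- divisors m | ~~ (p %| e)%N]).
    apply: uniq_perm; rewrite ?filter_uniq ?divisors_uniq //.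
      rewrite map_inj_uniq ?filter_uniq ?divisors_uniq // => a b /eqP.
      by rewrite eqn_pmul2l // => /eqP.
    move=> d; rewrite mem_filter -dvdn_divisors //.
    apply/idP/mapP => [/andP[/andP[pd nd] dm]|[e]].
      exists (d %/ p)%N; last by rewrite mulnC divnK.
      by rewrite mem_filter nd -dvdn_divisors // (dvdn_trans _ dm) // dvdn_div.
    rewrite mem_filter -dvdn_divisors // => /andP[ne em] ->.
    by rewrite dvdn_mulr // mulKn // ne Gauss_dvd ?prime_coprime ?pm.
  rewrite (perm_big _ perm) /= big_map !big_filter.
  rewrite big_seq_cond [RHS]big_seq_cond; apply: eq_bigr => e /andP[].
  rewrite -dvdn_divisors // => em ne.
  by rewrite mobius_primeM ?opprK // (dvdn_gt0 m0 em).
move=> d /andP[pd pdd]; have -> : d = (p * (d %/ p))%N by rewrite mulnC divnK.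
exact: mobius_square.
Qed.

Lemma big_divisors_dvd (R : nmodType) (f : nat -> R) e m :
  (0 < m)%N -> (e %| m)%N ->
  \sum_(d <- divisors m | (d %| e)%N) f d = \sum_(d <- divisors e) f d.
Proof.
move=> m0 em; have e0 := dvdn_gt0 m0 em.
rewrite -big_filter; apply: perm_big; apply: uniq_perm.
- by rewrite filter_uniq // divisors_uniq.
- exact: divisors_uniq.
move=> d; rewrite mem_filter -!dvdn_divisors //.
by case: (boolP (d %| e)%N) => // de; rewrite (dvdn_trans de em).
Qed.

Lemma sum_mobius_dvd e m : (0 < m)%N -> (e %| m)%N ->
  \sum_(d <- divisors m | (d %| e)%N) mobius d = (e == 1%N)%:R :> int.
Proof.
by move=> m0 em; rewrite big_divisors_dvd // sum_mobius // (dvdn_gt0 m0 em).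
Qed.

(** * Zeros of separable polynomials over an algebraically closed field *)

Lemma dvdp_root (R : idomainType) (f p : {poly R}) x :
  f %| p -> root f x -> root p x.
Proof. by rewrite -!dvdp_XsubCl => fp /dvdp_trans; apply. Qed.

Definition zeros (K : closedFieldType) (p : {poly K}) : seq K :=
  sval (closed_field_poly_normal p).

Lemma zerosE (K : closedFieldType) (p : {poly K}) :
  p = lead_coef p *: \prod_(z <- zeros p) ('X - z%:P).
Proof. exact: (svalP (closed_field_poly_normal p)). Qed.

Lemma mem_zeros (K : closedFieldType) (p : {poly K}) x :
  p != 0 -> (x \in zeros p) = root p x.
Proof.
by move=> p0; rewrite [in RHS](zerosE p) rootZ ?lead_coef_eq0 // root_prod_XsubC.
Qed.

Lemma size_zeros (K : closedFieldType) (p : {poly K}) :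
  p != 0 -> size (zeros p) = (size p).-1.
Proof.
move=> p0.
by rewrite [in RHS](zerosE p) size_scale ?lead_coef_eq0 // size_prod_XsubC.
Qed.

Lemma uniq_zeros (K : closedFieldType) (p : {poly K}) :
  separable_poly p -> uniq (zeros p).
Proof.
move=> sep; have p0 := separable_poly_neq0 sep.
rewrite -separable_prod_XsubC; apply: dvdp_separable sep.
by rewrite [X in _ %| X](zerosE p) dvdpZr ?dvdpp // lead_coef_eq0.
Qed.

Lemma count_root_zeros (K : closedFieldType) (p f : {poly K}) :
  separable_poly p -> f %| p -> count (root f) (zeros p) = (size f).-1.
Proof.
move=> sep fp; have p0 := separable_poly_neq0 sep.
have sepf := dvdp_separable fp sep; have f0 := separable_poly_neq0 sepf.
rewrite -size_filter -size_zeros //; apply: perm_size; apply: uniq_perm.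
- by rewrite filter_uniq // uniq_zeros.
- exact: uniq_zeros.
move=> x; rewrite mem_filter !mem_zeros //.
by case: (boolP (root f x)) => //= fx; apply: dvdp_root fx.
Qed.

(** * Frobenius levels in an algebraic closure of a finite field *)

(** The quotient by f is a field with q^(deg f) elements, so the class of X is
    a zero of X^(q^(deg f)) - X there. *)
Lemma irreducible_dvd_XqX (F : finFieldType) (f : {poly F}) :
  irreducible_poly f -> f \is monic ->
  f %| 'X^(#|F| ^ (size f).-1) - 'X.
Proof.
move=> irr_f mon_f; pose mi : monic_irreducible_poly f := (irr_f, mon_f).
have := expf_card (in_qpoly f 'X : {poly %/ f with mi}).
rewrite card_qfpoly => /eqP; rewrite -subr_eq0.
set u := in_qpoly f 'X; set N := (_ ^ _)%N.
have -> : (u : {poly %/ f with mi}) ^+ N - u = in_qpoly f ('X^N - 'X).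
  by rewrite rmorphB rmorphXn.
move=> /eqP/val_eqP /=; rewrite mk_monicE // -Pdiv.IdomainMonic.modpE //.
Qed.

Section Levels.

Variables (F : finFieldType) (K : closedFieldType) (iota : {rmorphism F -> K}).
Hypothesis iota_alg : integralRange iota.

Local Notation q := #|F|.
Local Notation "f ^i" := (map_poly iota f) (at level 2, format "f ^i").

(** For m > 0 this is the subfield of K with q^m elements. Describing it by a
    fixed-point equation turns inclusions of subfields into divisibilities. *)
Definition level (m : nat) (x : K) : bool := x ^+ (q ^ m) == x.

Lemma pchar_nat_card m : [pchar K].-nat (q ^ m)%N.
Proof.
have [p p_pr chF] := finPcharP F; rewrite pnatX; apply/orP; left.
have chK : p \in [pchar K] by rewrite (fmorph_pchar iota).
rewrite (eq_pnat _ (pcharf_eq chK)).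
by have := pprimeChar_pgroup chF; rewrite /pgroup cardsT.
Qed.

Lemma frobD m (x y : K) : (x + y) ^+ (q ^ m) = x ^+ (q ^ m) + y ^+ (q ^ m).
Proof. by rewrite exprDn_pchar // pchar_nat_card. Qed.

Lemma frobN m (x : K) : (- x) ^+ (q ^ m) = - x ^+ (q ^ m).
Proof. by rewrite exprNn_pchar // pchar_nat_card. Qed.

Lemma frobB m (x y : K) : (x - y) ^+ (q ^ m) = x ^+ (q ^ m) - y ^+ (q ^ m).
Proof. by rewrite frobD frobN. Qed.

Lemma card_expn_gt0 m : (0 < q ^ m)%N.
Proof. by rewrite expn_gt0 (ltnW (finNzRing_gt1 F)). Qed.

Lemma frob_inj m : injective (fun x : K => x ^+ (q ^ m)).
Proof.
move=> x y /eqP; rewrite -subr_eq0 -frobB expf_eq0 card_expn_gt0 /= subr_eq0.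
by move/eqP.
Qed.

Lemma frob_comp a b (x : K) : (x ^+ (q ^ a)) ^+ (q ^ b) = x ^+ (q ^ (a + b)).
Proof. by rewrite -exprM -expnD. Qed.

Lemma frob_iota m a : iota a ^+ (q ^ m) = iota a.
Proof.
rewrite -rmorphXn; congr (iota _).
by elim: m => [|m IH]; rewrite ?expr1 // expnSr exprM IH expf_card.
Qed.

Lemma frob_horner m (p : {poly K}) x :
  (forall i, level m p`_i) -> p.[x] ^+ (q ^ m) = p.[x ^+ (q ^ m)].
Proof.
elim/poly_ind: p => [|p c IH] lev_p.
  by rewrite !horner0 expr0n gtn_eqF // card_expn_gt0.
rewrite !hornerMXaddC frobD exprMn IH.
  have := lev_p 0; rewrite -cons_poly_def coef_cons /= => /eqP->.
  by [].
by move=> i; have := lev_p i.+1; rewrite -cons_poly_def coef_cons.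
Qed.

Lemma frob_horner_iota m (p : {poly F}) x :
  p^i.[x] ^+ (q ^ m) = p^i.[x ^+ (q ^ m)].
Proof.
by apply: frob_horner => i; rewrite coef_map /level frob_iota.
Qed.

Lemma levelD m x y : level m x -> level m y -> level m (x + y).
Proof. by rewrite /level frobD => /eqP-> /eqP->. Qed.

Lemma levelN m x : level m x -> level m (- x).
Proof. by rewrite /level frobN => /eqP->. Qed.

Lemma levelM m x y : level m x -> level m y -> level m (x * y).
Proof. by rewrite /level exprMn => /eqP-> /eqP->. Qed.

Lemma levelV m x : level m x -> level m x^-1.
Proof. by rewrite /level exprVn => /eqP->. Qed.

Lemma level_iota m a : level m (iota a).
Proof. by rewrite /level frob_iota. Qed.

Lemma level_horner m (p : {poly F}) x : level m x -> level m p^i.[x].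
Proof. by rewrite /level frob_horner_iota => /eqP->. Qed.

Lemma level_dvd m k x : (m %| k)%N -> level m x -> level k x.
Proof.
move=> /dvdnP[c ->]; rewrite /level => /eqP xm; apply/eqP.
by elim: c => [|c IH]; rewrite ?expr1 // mulSn -frob_comp xm.
Qed.

(** Bezout: if gcd (k, m) = u k - v m, then u k and v m Frobenius steps both fix x,
    and so does their difference. *)
Lemma level_gcd m k x : (0 < k)%N -> level m x -> level k x -> level (gcdn k m) x.
Proof.
move=> k0 xm xk; case: (egcdnP m k0) => u v Dg _.
have xuk : level (u * k) x by apply: level_dvd xk; apply: dvdn_mull.
have xvm : level (v * m) x by apply: level_dvd xm; apply: dvdn_mull.
by move: xuk; rewrite Dg /level -frob_comp (eqP xvm).
Qed.

Lemma level1_iota x : level 1 x -> exists a, x = iota a.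
Proof.
rewrite /level expn1 => xq.
have : root ('X^q - 'X)^i x.
  by rewrite rmorphB /= map_polyXn map_polyX rootE !hornerE subr_eq0.
rewrite finField_genPoly rmorph_prod rootE horner_prod prodf_seq_eq0 => /hasP[a _].
by rewrite /= map_polyXsubC -rootE root_XsubC => /eqP->; exists a.
Qed.

(** The derivative of X^(q^m) - X is -1. *)
Lemma separable_XqX m : (0 < m)%N ->
  separable_poly ('X^(q ^ m) - 'X : {poly K}).
Proof.
move=> m0; rewrite unlock derivB derivXn derivX.
have -> : ('X^((q ^ m).-1) *+ (q ^ m) : {poly K}) = 0.
  rewrite -mulr_natr -polyC_natr (_ : (q ^ m)%:R = 0 :> K) ?mulr0 //.
  have [p p_pr chF] := finPcharP F.
  have chK : p \in [pchar K] by rewrite (fmorph_pchar iota).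
  apply/eqP; rewrite -(dvdn_pcharf chK) Euclid_dvdX // m0 andbT.
  rewrite (card_pprimeChar chF) Euclid_dvdX // dvdnn /=.
  rewrite lt0n; apply/negP => /eqP n0; have := finNzRing_gt1 F.
  by rewrite (card_pprimeChar chF) n0.
by rewrite sub0r -(scaleN1r 1) coprimepZr ?coprimep1 // oppr_eq0 oner_eq0.
Qed.

Definition points (m : nat) : seq K := zeros ('X^(q ^ m) - 'X).

Lemma XqX_neq0 m : (0 < m)%N -> ('X^(q ^ m) - 'X : {poly K}) != 0.
Proof. by move=> m0; apply: separable_poly_neq0; apply: separable_XqX. Qed.

Lemma mem_points m x : (0 < m)%N -> (x \in points m) = level m x.
Proof.
move=> m0; rewrite mem_zeros ?XqX_neq0 // rootE !hornerE.
by rewrite subr_eq0.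
Qed.

Lemma uniq_points m : (0 < m)%N -> uniq (points m).
Proof. by move=> m0; apply: uniq_zeros; apply: separable_XqX. Qed.

Lemma size_points m : (0 < m)%N -> size (points m) = (q ^ m)%N.
Proof.
move=> m0; rewrite size_zeros ?XqX_neq0 // size_polyDl size_polyXn //.
rewrite size_polyN size_polyX ltnS.
exact: leq_ltn_trans m0 (ltn_expl m (finNzRing_gt1 F)).
Qed.

Lemma irreducible_root_dvd (f p : {poly F}) x :
  irreducible_poly f -> root f^i x -> root p^i x -> f %| p.
Proof.
move=> irr fx px; apply: contraT; rewrite -irreducible_poly_coprime //.
rewrite -(coprimep_map iota) => /(coprimep_root) /(_ fx).
by rewrite -rootE px.
Qed.

(** The q^k distinct values at x of the polynomials of degree less than k all
    lie in any level that contains x, which bounds that level from below. *)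
Lemma level_root (f : {poly F}) x m :
  irreducible_poly f -> f \is monic -> root f^i x ->
  level m x = ((size f).-1 %| m)%N.
Proof.
move=> irr mon fx; set k := (size f).-1.
have k0 : (0 < k)%N by rewrite /k -ltnS prednK ?irr.1 // ltnW ?irr.1.
have xk : level k x.
  have := irreducible_dvd_XqX irr mon; rewrite -(dvdp_map iota) => /dvdp_root.
  move=> /(_ _ fx); rewrite rmorphB /= map_polyXn map_polyX rootE !hornerE.
  by rewrite subr_eq0.
apply/idP/idP => [xm|]; last by move=> km; apply: level_dvd xk.
have xg := level_gcd k0 xm xk; set g := gcdn k m in xg.
have g0 : (0 < g)%N by rewrite gcdn_gt0 k0.
pose ev (p : {poly_k F}) := (polyn p)^i.[x].
have ev_inj : injective ev.
  move=> p r /eqP; rewrite -subr_eq0 -hornerN -hornerD -rmorphB => rt.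
  apply/val_inj/eqP; rewrite /= -subr_eq0; apply: contraT => nz.
  have /(dvdp_leq nz) := irreducible_root_dvd irr fx rt.
  rewrite leqNgt => /negP[]; rewrite -(prednK (ltnW irr.1)) ltnS.
  by rewrite (leq_trans (size_polyD _ _)) // geq_max size_polyN !size_npoly.
have : (size (map ev (enum {: {poly_k F}})) <= size (points g))%N.
  apply: uniq_leq_size; first by rewrite map_inj_uniq ?enum_uniq.
  by move=> _ /mapP[p _ ->]; rewrite mem_points // level_horner.
rewrite size_map -cardE card_npoly size_points // leq_exp2l ?finNzRing_gt1 //.
move=> kg; have : g = k by apply/eqP; rewrite eqn_leq kg dvdn_leq // dvdn_gcdl.
by move=> <-; apply: dvdn_gcdr.
Qed.

Lemma minimal_poly x : exists f : {poly F},
  [/\ f \is monic, root f^i x & irreducible_poly f].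
Proof.
have dec : decidable_embedding iota.
  move=> y; case: (boolP [exists a, iota a == y]) => [/existsP h|/existsP h].
    by left; case: (pickP (fun a => iota a == y)) => [a /eqP<-|/(_ _)n];
      [exists a|case: h => a; rewrite n].
  by right=> [[a ya]]; apply: h; exists a; rewrite ya.
by have [f [? ? ?]] := minPoly_decidable_closure dec (iota_alg x); exists f.
Qed.

(** * Cubics over a level *)

(** Frobenius permutes the three roots; without fixed point it is a 3-cycle. *)
Lemma cubic_root_level d (p : {poly K}) x :
  p \is monic -> size p = 4 -> (forall i, level d p`_i) ->
  (forall y, root p y -> ~~ level d y) -> root p x -> level (3 * d) x.
Proof.
move=> mon sz lev nofix px; pose Phi (y : K) := y ^+ (q ^ d).
have rPhi y : root p y -> root p (Phi y).
  by rewrite !rootE /Phi -frob_horner // => /eqP->; rewrite expr0n gtn_eqF ?card_expn_gt0.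
have nofix' y : root p y -> Phi y != y by move/nofix.
have x1x : Phi x != x by apply: nofix'.
have [u Du] := factor_theorem p x px.
have ux1 : root u (Phi x).
  have := rPhi _ px; rewrite Du rootM root_XsubC (negPf x1x) orbF.
  by [].
have [v Dv] := factor_theorem u (Phi x) ux1.
have [z Dz] : exists z, v = 'X - z%:P.
  have vmon : v \is monic.
    by move: mon; rewrite Du Dv !monicMr ?monicXsubC.
  have sv : size v = 2.
    move: sz; rewrite Du Dv !size_Mmonic ?monicXsubC ?monic_neq0 ?monicMr ?monicXsubC //.
    by rewrite !size_XsubC ![(_ + 2)%N]addnC => -[].
  exists (- v`_0); apply/polyP => i; rewrite coefB coefX coefC.
  case: i => [|[|i]]; rewrite /= ?sub0r ?opprK ?subr0 //.
    by have /monicP := vmon; rewrite lead_coefE sv.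
  by rewrite nth_default ?sv ?oppr0.
have Dp : p = ('X - z%:P) * ('X - (Phi x)%:P) * ('X - x%:P) by rewrite Du Dv Dz.
have roots y : root p y -> [|| y == z, y == Phi x | y == x].
  by rewrite Dp !rootM !root_XsubC orbA.
(* The sum of the roots is a coefficient of p, hence fixed by Frobenius. *)
have sum_fix : Phi (x + Phi x + z) = x + Phi x + z.
  have := lev 2; rewrite /level (_ : p`_2 = - (x + Phi x + z)).
    by rewrite (frobN d) eqr_opp => /eqP.
  rewrite Dp -!mulrA mulrBl coefB coefXM coefCM /=.
  rewrite !(mulrBl, mulrBr) !(coefB, coefXM, coefMX, coefCM, coefMC, coefX, coefC) /=.
  ring.
have PhiD a b : Phi (a + b) = Phi a + Phi b by apply: frobD.
have zp : root p z by rewrite Dp !rootM !root_XsubC eqxx.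
have : root p (Phi (Phi x)) by apply/rPhi/rPhi.
have x2x1 : Phi (Phi x) != Phi x by apply/nofix'/rPhi.
move/roots; rewrite (negPf x2x1) => /orP[/eqP x2z|/eqP x2x]; last first.
  case/negP: (nofix' _ zp); apply/eqP; move: sum_fix.
  by rewrite !PhiD x2x (addrC (Phi x)) => /addrI.
have : Phi z = x.
  by move: sum_fix; rewrite !PhiD x2z -[RHS]addrA [RHS]addrC => /addrI.
rewrite -x2z /Phi !frob_comp /level => {2}<-; apply/eqP; congr (_ ^+ (_ ^ _)).
by rewrite !mulSn addn0 addnA.
Qed.

(** * The fibres of a rational map of degree three *)

Section Fibres.

Variables g h : {poly F}.
Hypothesis g_monic : g \is monic.
Hypothesis size_g : size g = 4.
Hypothesis size_h : (size h < 4)%N.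
Hypothesis coprime_gh : coprimep g h.

Definition fibre (a : K) : {poly K} := g^i - a *: h^i.

Lemma size_fibre a : size (fibre a) = 4.
Proof.
rewrite size_polyDl ?size_map_poly // size_polyN.
by apply: leq_ltn_trans (size_scale_leq _ _) _; rewrite size_map_poly size_g.
Qed.

Lemma monic_fibre a : fibre a \is monic.
Proof.
apply/monicP; rewrite lead_coefE size_fibre coefB coefZ !coef_map /=.
rewrite [h`_3]nth_default // rmorph0 mulr0 subr0.
by have /monicP := g_monic; rewrite lead_coefE size_g /= => ->; rewrite rmorph1.
Qed.

Lemma root_fibre a x : root (fibre a) x = (g^i.[x] == a * h^i.[x]).
Proof. by rewrite rootE !hornerE subr_eq0. Qed.

Lemma fibre_denom_neq0 a x : root (fibre a) x -> h^i.[x] != 0.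
Proof.
rewrite root_fibre => /eqP gx; apply/eqP => hx.
have gx0 : root g^i x by rewrite rootE gx hx mulr0.
have := coprime_gh; rewrite -(coprimep_map iota) => /coprimep_root /(_ gx0).
by rewrite hx eqxx.
Qed.

(** The point a is the value of g / h at x. *)
Lemma level_fibre m a x : root (fibre a) x -> level m x -> level m a.
Proof.
move=> ax xm; have hx := fibre_denom_neq0 ax.
have -> : a = g^i.[x] / h^i.[x].
  by move: ax; rewrite root_fibre => /eqP->; rewrite mulfK.
by apply: levelM; last apply: levelV; apply: level_horner.
Qed.

Lemma fibre_root_exists a : exists x, root (fibre a) x.
Proof. by apply/closed_rootP; rewrite size_fibre. Qed.

(** Boolean, through the list of the q^m points of the level, so that the points
    with empty fibre can be counted. *)
Definition empty_fibre (m : nat) (a : K) : bool :=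
  level m a && all (fun x => ~~ root (fibre a) x) (points m).

Lemma empty_fibreP m a : (0 < m)%N ->
  reflect (level m a /\ forall x, root (fibre a) x -> ~~ level m x)
          (empty_fibre m a).
Proof.
move=> m0; apply: (iffP andP) => -[am /[dup] H nox]; split=> //.
  move=> x ax; apply/negP => xm; move/allP: H => /(_ x).
  by rewrite mem_points // xm ax => /(_ isT).
apply/allP => x; rewrite mem_points // => xm; apply/negP => /nox.
by rewrite xm.
Qed.

Lemma empty_fibre_level3 d a x : (0 < d)%N ->
  empty_fibre d a -> root (fibre a) x -> level (3 * d) x.
Proof.
move=> d0 /empty_fibreP[] // ad nox; apply: cubic_root_level => //.
- exact: monic_fibre.
- exact: size_fibre.
move=> i; rewrite coefB coefZ !coef_map /= levelD ?levelN ?levelM //;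
  exact: level_iota.
Qed.

(** The fibre of a lies in level 3d. If it misses level d, it can meet only
    those levels d e that contain level 3d: an intersection of level 3d with
    level d e is level d unless 3 divides e. *)
Lemma empty_fibreM d e a : (0 < d)%N -> (0 < e)%N -> level d a ->
  empty_fibre (d * e) a = empty_fibre d a && ~~ (3 %| e)%N.
Proof.
move=> d0 e0 ad; have de0 : (0 < d * e)%N by rewrite muln_gt0 d0.
apply/(empty_fibreP _ de0)/andP => [[_ nox]|[Ed ne]].
  have Ed : empty_fibre d a.
    apply/empty_fibreP => //; split=> // x /nox; apply: contra.
    by apply: level_dvd; apply: dvdn_mulr.
  split=> //; apply/negP => e3; have [x ax] := fibre_root_exists a.
  have x3 := empty_fibre_level3 d0 Ed ax; move: (nox _ ax).
  rewrite (level_dvd _ x3) // mulnC dvdn_pmul2l //.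
have am : level (d * e) a by apply: level_dvd ad; apply: dvdn_mulr.
split=> // x ax; have x3 := empty_fibre_level3 d0 Ed ax.
have /empty_fibreP[//|_ /(_ _ ax)] := Ed; apply: contra => xde.
have := level_gcd de0 x3 xde; rewrite [(3 * d)%N]mulnC -muln_gcdr.
by rewrite (eqP (_ : coprime e 3)) ?muln1 // coprime_sym prime_coprime.
Qed.

Lemma size_transform n (f : {poly F}) : f \is monic -> size f = n.+1 ->
  size (rat_transform g h n f) = (3 * n).+1.
Proof.
move=> mon sf; rewrite /rat_transform big_ord_recr /= subnn expr0 mulr1.
have /monicP := mon; rewrite lead_coefE sf /= => ->; rewrite scale1r.
have sgn i : size (g ^+ i) = (3 * i).+1.
  rewrite -[LHS]prednK ?size_exp ?size_g //.
  by rewrite size_poly_gt0 expf_neq0 // monic_neq0.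
rewrite addrC size_polyDl sgn // ltnS; apply: (leq_trans (size_sum _ _ _)).
apply/bigmax_leqP => i _; apply: leq_trans (size_scale_leq _ _) _.
apply: leq_trans (size_polyMleq _ _) _; rewrite sgn.
have := size_poly_exp_leq h (n - i).
have : (((size h).-1 * (n - i)) <= 2 * (n - i))%N.
  by rewrite leq_mul2r; apply/orP; right; case: (size h) size_h.
by move: (_ * _)%N (size (h ^+ _)) (ltn_ord i) => A B; lia.
Qed.

Lemma transform_root n (f : {poly F}) a x : size f = n.+1 ->
  root f^i a -> root (fibre a) x -> root (rat_transform g h n f)^i x.
Proof.
move=> sf fa; rewrite root_fibre => /eqP gx.
rewrite rootE.
have -> : (rat_transform g h n f)^i.[x] = h^i.[x] ^+ n * f^i.[a]; last first.
  by rewrite (eqP fa) mulr0.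
rewrite [f^i.[a]](@horner_coef_wide _ n.+1) ?size_map_poly ?sf // mulr_sumr.
rewrite /rat_transform rmorph_sum horner_sum; apply: eq_bigr => i _.
rewrite /= map_polyZ rmorphM !rmorphXn /= !hornerE gx coef_map /= exprMn.
have -> : h^i.[x] ^+ n = h^i.[x] ^+ i * h^i.[x] ^+ (n - i).
  by rewrite -exprD subnKC // -ltnS.
ring.
Qed.

(** A point x of the fibre of a is a root of the transform, and its degree over F
    is a multiple of n that divides 3 n when the fibre misses level n. So this
    degree is then 3 n, the degree of the transform; otherwise some x of degree
    at most n is a root of the transform. *)
Lemma transform_irreducibleP n (f : {poly F}) a : (0 < n)%N ->
  f \is monic -> irreducible_poly f -> size f = n.+1 -> root f^i a ->
  irreducible_poly (rat_transform g h n f) <-> empty_fibre n a.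
Proof.
move=> n0 mon irr sf fa; set P := rat_transform g h n f.
have sP : size P = (3 * n).+1 by apply: size_transform.
have P0 : P != 0 by rewrite -size_poly_eq0 sP.
have la m : level m a = (n %| m)%N by rewrite (level_root _ irr mon fa) sf.
have QdvdP Q x : irreducible_poly Q -> Q \is monic -> root Q^i x ->
    root (fibre a) x -> Q %| P.
  by move=> irrQ _ Qx ax; apply: (irreducible_root_dvd irrQ Qx); apply: transform_root ax.
split=> [irrP|/empty_fibreP[//|an nox]].
  apply/empty_fibreP => //; rewrite la dvdnn; split=> // x ax; apply/negP => xn.
  have [Q [monQ Qx irrQ]] := minimal_poly x.
  have QP := QdvdP _ _ irrQ monQ Qx ax.
  have /eqp_size := irrP.2 _ (negbT (gtn_eqF irrQ.1)) QP.
  rewrite sP => sQ; move: xn; rewrite (level_root _ irrQ monQ Qx) sQ /=.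
  by move/(dvdn_leq n0); rewrite leqNgt ltn_Pmull.
have [x ax] := fibre_root_exists a.
have [Q [monQ Qx irrQ]] := minimal_poly x.
have QP := QdvdP _ _ irrQ monQ Qx ax.
have lx m : level m x = ((size Q).-1 %| m)%N by rewrite (level_root _ irrQ monQ Qx).
have nQ : (n %| (size Q).-1)%N by rewrite -la; apply: level_fibre ax _; rewrite lx.
have Q3 : ((size Q).-1 %| 3 * n)%N.
  rewrite -lx; apply: empty_fibre_level3 ax => //; apply/empty_fibreP => //.
have nQn : ~~ ((size Q).-1 %| n)%N by rewrite -lx; apply: nox.
have sQ : (size Q).-1 = (3 * n)%N.
  case/dvdnP: nQ => j Dj; move: Q3 nQn; rewrite Dj dvdn_pmul2r //.
  by rewrite dvdn_divisors // !inE => /orP[]/eqP->; rewrite ?mul1n ?dvdnn.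
have eqPQ : Q %= P.
  by rewrite -dvdp_size_eqp // sP -sQ prednK // ltnW ?irrQ.1.
split=> [|r r1 rP]; first by rewrite -(eqp_size eqPQ) irrQ.1.
rewrite -(eqp_rtrans eqPQ) irrQ.2 //; by rewrite (eqp_dvdr _ eqPQ).
Qed.

(** * Counting irreducible transforms by Frobenius orbits *)

(** Let k be the degree of a over F and e = n / k. On the left only the minimal
    polynomial of a can contribute, and it does if e = 1 and the fibre of a
    misses level n. On the right the divisors d of e, being prime to 3, all carry
    the same truth value, so that the Moebius sum over them again forces e = 1. *)
Lemma irr_transform_root_sum n a : (0 < n)%N -> level n a ->
  \sum_(f in irr_transform_set g h n) (root (polyn f)^i a)%:R =
  \sum_(d <- divisors (n`_3^')%N) mobius d * (empty_fibre (n %/ d) a)%:R :> int.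
Proof.
move=> n0 an; have [f [mon fa irr]] := minimal_poly a.
have la m : level m a = ((size f).-1 %| m)%N by rewrite (level_root _ irr mon fa).
move: la; set k := (size f).-1 => la.
have k0 : (0 < k)%N by rewrite /k -ltnS prednK ?irr.1 // ltnW ?irr.1.
have sf : size f = k.+1 by rewrite /k prednK // ltnW ?irr.1.
have ak : level k a by rewrite la.
have kn : (k %| n)%N by rewrite -la.
pose e := (n %/ k)%N; have Dn : n = (k * e)%N by rewrite mulnC divnK.
have e0 : (0 < e)%N by move: n0; rewrite Dn muln_gt0 => /andP[].
have m0 : (0 < n`_3^')%N by apply: part_gt0.
transitivity (((empty_fibre k a && ~~ (3 %| e)%N) && (e == 1%N))%:R : int); last first.
  rewrite big_seq (eq_bigr (fun d => if (d %| e)%N then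
      mobius d * (empty_fibre k a && ~~ (3 %| e)%N)%:R else 0)); last first.
    move=> d; rewrite -dvdn_divisors // => dm.
    have d0 := dvdn_gt0 m0 dm.
    have dn : (d %| n)%N by rewrite (dvdn_trans dm) // dvdn_part.
    have d3 : coprime 3 d.
      by rewrite prime_coprime // -p'natE //; apply: pnat_dvd dm (part_pnat _ _).
    have -> : (d %| e)%N = (k %| n %/ d)%N.
      by rewrite dvdn_divRL // -[in RHS](divnK kn) -/e mulnC dvdn_pmul2r.
    case: ifP => [kd|/negbT]; last first.
      rewrite -la => nd; rewrite (_ : empty_fibre _ _ = false) ?mulr0 //.
      by apply/negP => /andP[ad _]; rewrite ad in nd.
    have de : (d %| e)%N.
      by move: kd; rewrite dvdn_divRL // -[X in (_ %| X)%N](divnK kn) -/e mulnC dvdn_pmul2r.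
    rewrite -(divnK de) Dn -[in LHS](divnK de) mulnA mulnK //.
    rewrite empty_fibreM //; last first.
      by rewrite divn_gt0 // dvdn_leq.
    by rewrite Gauss_dvdl.
  rewrite -big_seq -big_mkcond -mulr_suml.
  case: (empty_fibre k a); last by rewrite mulr0.
  case: (boolP (3 %| e)%N) => [_|e3]; first by rewrite mulr0.
  rewrite mulr1 sum_mobius_dvd //.
  have : (e %| n)%N by rewrite Dn dvdn_mull.
  rewrite -{1}(partnC 3%N n0) mulnC Gauss_dvdl // coprime_sym.
  by apply: pnat_coprime (part_pnat 3%N n) _; rewrite p'natE.
rewrite big_mkcond /=.
have inS (p : {poly_n.+1 F}) : (p \in irr_transform_set g h n) && root (polyn p)^i a ->
    polyn p = f /\ (e == 1%N) && empty_fibre n a.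
  rewrite inE => /andP[/and4P[mp /eqP sp /irreducibleP ip /irreducibleP iT] pa].
  have pf : polyn p = f.
    apply/eqP; rewrite -eqp_monic // /eqp.
    by rewrite (irreducible_root_dvd ip pa fa) (irreducible_root_dvd irr fa pa).
  split=> //; rewrite (transform_irreducibleP n0 mp ip sp pa).1 // andbT.
  by rewrite /e /k -pf sp /= divnn n0.
case: eqP => [e1|ne]; last first.
  rewrite andbF big1 // => p _; case: ifP => // pS.
  by case: (boolP (root _ _)) => // pa; case: (inS p) => [|_ /andP[/eqP]]; rewrite ?pS ?pa.
have nk : n = k by rewrite Dn e1 muln1.
rewrite e1 !andbT -nk.
case: (boolP (empty_fibre n a)) => [En|nE]; last first.
  rewrite big1 // => p _; case: ifP => // pS.
  case: (boolP (root _ _)) => // pa; case: (inS p) => [|_]; rewrite ?pS ?pa //.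
  by rewrite (negPf nE) andbF.
have sf1 : size f = n.+1 by rewrite sf nk.
have sfn : (size f <= n.+1)%N by rewrite sf1.
pose fn : {poly_n.+1 F} := NPoly sfn.
have fS : fn \in irr_transform_set g h n.
  rewrite inE; apply/and4P; split=> //=; first by rewrite sf1.
    exact/irreducibleP.
  by apply/irreducibleP; rewrite (transform_irreducibleP n0 mon irr sf1 fa).
rewrite (bigD1 fn) //= fS fa big1 ?addr0 // => p pfn; case: ifP => // pS.
case: (boolP (root _ _)) => // pa; case: (inS p) => [|pf _]; first by rewrite pS pa.
by case/eqP: pfn; apply/val_inj.
Qed.

(** Every polynomial in the set has exactly n roots, all of level n; exchanging
    the sums over polynomials and over points reduces the count to single
    points. *)
Theorem card_irr_transform n : (0 < n)%N ->
  (n * #|irr_transform_set g h n|)%N%:R =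
  \sum_(d <- divisors (n`_3^')%N)
     mobius d * (count (empty_fibre (n %/ d)) (points n))%:R :> int.
Proof.
move=> n0; transitivity (\sum_(f in irr_transform_set g h n)
    (\sum_(a <- points n) (root (polyn f)^i a)%:R : int)).
  rewrite mulnC natrM mulr_natl -sumr_const; apply: eq_bigr => f.
  rewrite inE => /and4P[mf /eqP sf /irreducibleP irr _].
  rewrite -natr_sum.
  have := irreducible_dvd_XqX irr mf; rewrite sf -(dvdp_map iota).
  rewrite rmorphB /= map_polyXn map_polyX => /(count_root_zeros (separable_XqX n0)).
  rewrite size_map_poly sf /= => cnt; rewrite -[in LHS]cnt.
  by rewrite -sum1_count big_mkcond; congr _%:R; apply: eq_bigr => a _; case: root.
rewrite exchange_big /= big_seq (eq_bigr (fun a =>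
  \sum_(d <- divisors (n`_3^')%N) mobius d * (empty_fibre (n %/ d) a)%:R)); last first.
  by move=> a; rewrite mem_points // => /(irr_transform_root_sum n0).
rewrite -big_seq exchange_big /=; apply: eq_bigr => d _.
rewrite -mulr_sumr -sum1_count natr_sum [X in _ = _ * X]big_mkcond /=; congr (_ * _).
by apply: eq_bigr => a _; case: empty_fibre.
Qed.

End Fibres.

End Levels.

(** * The map and its conjugate, the cube map *)

(** Squaring is a Galois automorphism, so x and its square have the same
    trace; this trace is in the prime field, where squaring is trivial. *)
Lemma abs_trace_artin_schreier (F : finFieldType) (charF2 : 2%N \in [pchar F])
    (x : F) : abs_trace charF2 (x ^+ 2 + x) = 0.
Proof.
rewrite /abs_trace; set L := pPrimeCharType charF2.
pose Tr := galTrace 1%VS {:L}%VS; pose y : L := x.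
have charL : 2%N \in [pchar L] by exact: charF2.
have addTr (u v : L) : Tr (u + v) = Tr u + Tr v by apply: raddfD.
have sqTr (u : L) : Tr (u ^+ 2) = Tr u ^+ 2.
  rewrite /Tr /galTrace -[RHS](pFrobenius_autE charL) rmorph_sum.
  by apply: eq_bigr => s _; apply: rmorphXn.
have : Tr y \in 1%VS.
  by apply: mem_galTrace; rewrite ?memvf // finField_galois ?sub1v.
case/vlineP => c Dc; change (Tr (y ^+ 2 + y) = 0); rewrite addTr sqTr Dc.
have c2 : c ^+ 2 = c by case: c {Dc} => [[|[|c]] lt_c] //=; apply/val_inj.
rewrite exprZn expr1n c2.
by have := addrr_pchar2 charL (c *: (1 : L)).
Qed.

Section CubeMap.

Variables (F : finFieldType) (K : closedFieldType) (iota : {rmorphism F -> K}).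
Hypothesis iota_alg : integralRange iota.
Hypothesis charF2 : 2%N \in [pchar F].
Variable sigma : F.
Hypothesis tr_sigma : abs_trace charF2 sigma = 1.

Local Notation q := #|F|.
Local Notation "f ^i" := (map_poly iota f) (at level 2, format "f ^i").

Let g : {poly F} := 'X^3 + sigma *: 'X + sigma%:P.
Let h : {poly F} := 'X^2 + 'X + (sigma + 1)%:P.

Lemma size_num : size g = 4.
Proof.
rewrite /g -addrA size_polyDl size_polyXn //.
rewrite ltnS (leq_trans (size_polyD _ _)) // geq_max size_polyC.
rewrite (leq_trans (size_scale_leq _ _)) ?size_polyX //.
by case: (sigma != 0).
Qed.

Lemma monic_num : g \is monic.
Proof.
apply/monicP; rewrite lead_coefE size_num /g !coefE /=.
by rewrite mulr0 !addr0.
Qed.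

Lemma size_den : (size h < 4)%N.
Proof.
rewrite /h -addrA size_polyDl size_polyXn //.
rewrite ltnS (leq_trans (size_polyD _ _)) // geq_max size_polyC size_polyX.
by case: (_ != 0).
Qed.

Lemma pchar2_poly : 2%:R = 0 :> {poly F}.
Proof. by rewrite -polyC_natr (pcharf0 charF2). Qed.

(** In characteristic two, g = (X + 1) h + 1. *)
Lemma coprime_num_den : coprimep g h.
Proof.
apply/Bezout_coprimepP; exists (1, 'X + 1) => /=.
suff -> : 1 * g + ('X + 1) * h = 1 by apply: eqpxx.
have -> : 1 * g + ('X + 1) * h =
    1 + 2%:R * ('X^3 + 'X^2 + sigma%:P * 'X + 'X + sigma%:P).
  by rewrite /g /h -mul_polyC polyCD; ring.
by rewrite pchar2_poly mul0r addr0.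
Qed.

Lemma two0 : 2%:R = 0 :> K.
Proof. by rewrite -(rmorph_nat iota) (pcharf0 charF2) rmorph0. Qed.

Lemma charK2 : 2%N \in [pchar K].
Proof. by rewrite (fmorph_pchar iota). Qed.

(** Identities in characteristic two are verified as identities over the
    integers up to an explicit even term. *)
Lemma eq_mod2 (x y z : K) : x = y + 2%:R * z -> x = y.
Proof. by rewrite two0 mul0r addr0. Qed.

Lemma add1_neq (x y : K) : x != y + 1 -> x + y + 1 != 0.
Proof. by rewrite -addrA addr_eq0 oppr_pchar2 // charK2. Qed.

Lemma add_neq (x y : K) : x != y -> x + y != 0.
Proof. by rewrite addr_eq0 oppr_pchar2 // charK2. Qed.

Lemma artin_schreier_root : exists t : K, t ^+ 2 + t = iota sigma.
Proof.
have [|t] := closed_rootP ('X^2 + 'X + (iota sigma)%:P : {poly K}) _.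
  rewrite -addrA size_polyDl size_polyXn //.
  rewrite ltnS (leq_trans (size_polyD _ _)) // geq_max size_polyC size_polyX.
  by case: (_ != 0).
rewrite rootE !hornerE addr_eq0 oppr_pchar2 ?charK2 // => /eqP; by exists t.
Qed.

Variable t : K.
Hypothesis Dt : t ^+ 2 + t = iota sigma.

(** The conjugates of t are t and t + 1, and t is not in F because sigma has
    nonzero trace, unlike the elements a^2 + a of F. *)
Lemma frob_t m : t ^+ (q ^ m) = t + (odd m)%:R.
Proof.
have Ft : t ^+ q = t + 1.
  have Dtq : (t ^+ q) ^+ 2 + t ^+ q = iota sigma.
    rewrite -(frob_iota iota 1 sigma) expn1 -Dt.
    by have := frobD iota 1 (t ^+ 2) t; rewrite expn1 => ->; rewrite exprAC.
  have : (t ^+ q - t) * (t ^+ q + t + 1) == 0.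
    apply/eqP; transitivity ((t ^+ q) ^+ 2 + t ^+ q - (t ^+ 2 + t)); first by ring.
    by rewrite Dtq Dt subrr.
  rewrite mulf_eq0 => /orP[|/eqP tq].
    rewrite subr_eq0 => tq; have [|a Da] := @level1_iota _ _ iota t.
      by rewrite /level expn1.
    have : a ^+ 2 + a = sigma.
      by apply: (fmorph_inj iota); rewrite rmorphD rmorphXn -Da.
    move=> Ds; have := abs_trace_artin_schreier charF2 a.
    by rewrite Ds tr_sigma => /eqP; rewrite oner_eq0.
  move/eqP: tq; rewrite -addrA addr_eq0 oppr_pchar2 ?charK2 //.
  by move/eqP.
elim: m => [|m IH]; first by rewrite expr1 addr0.
rewrite expnSr exprM IH; have := frobD iota 1 t (odd m)%:R; rewrite expn1 => ->.
rewrite Ft /=; case: (odd m) => /=.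
  by rewrite expr1n -addrA (addrr_pchar2 charK2).
by rewrite expr0n gtn_eqF ?addr0 // ltnW // finNzRing_gt1.
Qed.

(** The change of coordinate that turns g / h into the cube map: in
    characteristic two g + t h = (X + t)^3 and g + (t + 1) h = (X + t + 1)^3. *)
Definition phi (x : K) : K := (x + t) / (x + t + 1).

(** This is the equation phi x ^ 3 = phi a with denominators cleared, valid
    also where phi has its pole. *)
Lemma root_fibreE a x :
  root (fibre iota g h a) x =
  ((x + t) ^+ 3 * (a + t + 1) == (x + t + 1) ^+ 3 * (a + t)).
Proof.
rewrite root_fibre -[LHS]subr_eq0 -[RHS]subr_eq0; congr (_ == _).
rewrite /g /h !rmorphD /= map_polyZ !map_polyXn map_polyX !map_polyC /= !hornerE.
rewrite ?rmorph1 -Dt; symmetry.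
apply: (@eq_mod2 _ _ (- (2%:R * x * t ^+ 2 + 2%:R * x * t + t ^+ 3
  + 2%:R * t ^+ 2 + t + a * (x ^+ 2 + 3%:R * x * t + t ^+ 2 + x + t)))).
rewrite /=; ring.
Qed.

(** The order of the group in which phi takes its values at level m. When m is
    odd, t is not of level m and this is the norm-one group of the quadratic
    extension; when m is even, phi is defined over level m and this is the
    multiplicative group. *)
Definition torus_order (m : nat) : nat :=
  if odd m then (q ^ m + 1)%N else (q ^ m - 1)%N.

Lemma card_exp_even m : (0 < m)%N -> odd (q ^ m) = false.
Proof.
move=> m0; apply: negbTE; rewrite -dvdn2 Euclid_dvdX // m0 andbT.
have [p p_pr chF] := finPcharP F; rewrite (card_pprimeChar charF2).
rewrite Euclid_dvdX // dvdnn /= lt0n; apply/eqP => n0.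
by have := finNzRing_gt1 F; rewrite (card_pprimeChar charF2) n0.
Qed.

Lemma torus_order_odd m : (0 < m)%N -> odd (torus_order m).
Proof.
move=> m0; rewrite /torus_order; case: ifP => _.
  by rewrite addn1 /= card_exp_even.
by rewrite oddB ?card_expn_gt0 // card_exp_even.
Qed.

Lemma torus_order_gt0 m : (0 < m)%N -> (0 < torus_order m)%N.
Proof. by move/torus_order_odd; case: torus_order. Qed.

Lemma torusE m (y : K) : (0 < m)%N -> y != 0 -> (y ^+ torus_order m == 1) =
  (y ^+ (q ^ m) == (if odd m then y^-1 else y)).
Proof.
move=> m0 y0; rewrite /torus_order; case: ifP => _.
  by rewrite addn1 exprSr -[RHS](inj_eq (mulIf y0)) mulVf.
rewrite -[in RHS](subnK (card_expn_gt0 F m)) addn1 exprSr.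
by rewrite -[LHS](inj_eq (mulIf y0)) mul1r.
Qed.

Lemma phi_eq0 x : x != t + 1 -> (phi x == 0) = (x == t).
Proof.
move=> xt1; rewrite /phi mulf_eq0 invr_eq0 (negPf (add1_neq xt1)) orbF.
by rewrite addr_eq0 oppr_pchar2 // charK2.
Qed.

Lemma phi_inj x y : x != t + 1 -> y != t + 1 -> phi x = phi y -> x = y.
Proof.
move=> /add1_neq x1 /add1_neq y1 /eqP; rewrite /phi eqr_div // => /eqP xy.
apply/eqP; rewrite -subr_eq0; apply/eqP.
transitivity ((x + t) * (y + t + 1) - (y + t) * (x + t + 1)); first by ring.
by rewrite xy subrr.
Qed.

Lemma phi_neq1 x : x != t + 1 -> phi x != 1.
Proof.
move=> /add1_neq x1; rewrite /phi -subr_eq0.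
rewrite (_ : _ - 1 = - (x + t + 1)^-1) ?oppr_eq0 ?invr_eq0 //.
by field.
Qed.

Lemma phi_surj y : y != 1 -> exists2 x, x != t + 1 & phi x = y.
Proof.
move=> y1; have y1' : y + 1 != 0 by apply: add_neq.
pose x := (t + (t + 1) * y) / (y + 1).
have xt1 : x + t + 1 = (y + 1)^-1.
  by apply: (@eq_mod2 _ _ ((t + t * y + y) / (y + 1))); rewrite /x; field.
have xt : x + t = y / (y + 1).
  by apply: (@eq_mod2 _ _ ((t + t * y) / (y + 1))); rewrite /x; field.
exists x; last by rewrite /phi xt1 xt invrK mulfVK.
apply/eqP => Dx; have := invr_neq0 y1'; rewrite -xt1 Dx.
by rewrite -addrA (addrr_pchar2 charK2) eqxx.
Qed.

(** The conjugation t |-> t + 1 turns phi into its inverse, so Frobenius sends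
    phi x to the value of phi at the conjugate of x or to its inverse. *)
Lemma level_phi m x : (0 < m)%N -> x != t -> x != t + 1 ->
  level F m x = (phi x ^+ torus_order m == 1).
Proof.
move=> m0 xt xt1; rewrite torusE ?phi_eq0 //.
have conj_t1 : (t + 1) ^+ (q ^ m) = t + (~~ odd m)%:R.
  rewrite (frobD iota) expr1n frob_t; case: (odd m) => /=; last by rewrite addr0.
  by rewrite -addrA (addrr_pchar2 charK2).
set X := x ^+ (q ^ m).
have Fx : (X != t) && (X != t + 1).
  case: (boolP (odd m)) => om.
    have -> : (X == t) = (x == t + 1).
      by rewrite -(inj_eq (@frob_inj _ _ iota m)) conj_t1 om addr0.
    have -> : (X == t + 1) = (x == t).
      by rewrite -(inj_eq (@frob_inj _ _ iota m)) frob_t om.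
    by rewrite xt xt1.
  have -> : (X == t) = (x == t).
    by rewrite -[RHS](inj_eq (@frob_inj _ _ iota m)) frob_t (negPf om) addr0.
  have -> : (X == t + 1) = (x == t + 1).
    by rewrite -[RHS](inj_eq (@frob_inj _ _ iota m)) conj_t1 om.
  by rewrite xt xt1.
have [Xt Xt1] := andP Fx.
have phiX : phi x ^+ (q ^ m) = if odd m then (phi X)^-1 else phi X.
  rewrite /phi exprMn exprVn !(frobD iota) expr1n frob_t -/X.
  case: (odd m) => /=; last by rewrite !addr0.
  rewrite invf_div; congr (_ / _); first by rewrite addrA.
  by rewrite -!addrA (addrr_pchar2 charK2) addr0.
have -> : (phi x ^+ (q ^ m) == (if odd m then (phi x)^-1 else phi x)) =
    (phi X == phi x).
  by rewrite phiX; case: (odd m); rewrite ?(inj_eq invr_inj).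
rewrite /level -/X; apply/eqP/eqP => [->//|]; exact: phi_inj.
Qed.

Lemma root_fibre_phi a x : a != t + 1 -> x != t + 1 ->
  root (fibre iota g h a) x = (phi x ^+ 3 == phi a).
Proof.
move=> a1 x1; rewrite root_fibreE /phi exprMn exprVn.
by rewrite eqr_div ?expf_neq0 ?add1_neq // [X in _ == X]mulrC.
Qed.

Lemma root_fibre_nondeg a x : a != t -> a != t + 1 ->
  root (fibre iota g h a) x -> (x != t) && (x != t + 1).
Proof.
move=> a0 a1; rewrite root_fibreE; apply: contraTT.
have tt0 : t + t = 0 by apply: addrr_pchar2 charK2 _.
have tt1 : t + 1 + t = 1 by rewrite addrAC tt0 add0r.
rewrite negb_and !negbK => /orP[]/eqP->.
  rewrite tt0 expr0n mul0r add0r expr1n mul1r eq_sym.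
  exact: add_neq.
rewrite tt1 (addrr_pchar2 charK2) expr0n expr1n mul0r mul1r.
exact: add1_neq.
Qed.

Definition noncube (m : nat) (y : K) : bool :=
  (3 %| torus_order m)%N && (y ^+ (torus_order m %/ 3) != 1).

(** In a cyclic group of order N, everything is a cube if 3 does not divide N,
    and otherwise the cubes are the elements killed by N / 3. *)
Lemma noncubeP m b : (0 < m)%N -> b ^+ torus_order m = 1 ->
  reflect (forall y, y ^+ torus_order m = 1 -> y ^+ 3 <> b) (noncube m b).
Proof.
move=> m0; rewrite /noncube; set N := torus_order m => bN.
have N0 : (0 < N)%N by apply: torus_order_gt0.
case: (boolP (3 %| N)%N) => /= [N3|nN3].
  apply: (iffP idP) => [bn y yN yb|nocube].
    by case/eqP: bn; rewrite -yb -exprM mulnC divnK.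
  apply/eqP => b1; have [|y] := closed_rootP ('X^3 - b%:P : {poly K}) _.
    by rewrite size_XnsubC.
  rewrite rootE !hornerE subr_eq0 => /eqP yb; apply: (nocube y) => //.
  by rewrite -(divnK N3) mulnC exprM yb.
apply: (iffP idP) => // nocube; exfalso.
case: (egcdnP N (isT : 0 < 3)%N) => u v Duv _.
apply: (nocube (b ^+ u)); first by rewrite exprAC bN expr1n.
rewrite -exprM Duv exprD mulnC exprM bN expr1n mul1r.
by rewrite (eqP (_ : coprime 3 N)) ?prime_coprime.
Qed.

Lemma empty_fibreE m a : (0 < m)%N -> empty_fibre iota g h m a =
  [&& a != t, a != t + 1, phi a ^+ torus_order m == 1 & noncube m (phi a)].
Proof.
move=> m0; apply/(empty_fibreP iota g h _ m0)/and4P => [[am nox]|[a0 a1 aN /noncubeP nc]].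
  have tt0 : t + t = 0 by apply: addrr_pchar2 charK2 _.
  have a0 : a != t.
    apply: contraL am => /eqP Da; apply: nox.
    by rewrite root_fibreE Da tt0 expr0n mul0r mulr0.
  have a1 : a != t + 1.
    apply: contraL am => /eqP Da; apply: nox.
    by rewrite root_fibreE Da addrAC tt0 add0r (addrr_pchar2 charK2) expr0n mul0r mulr0.
  have aN : phi a ^+ torus_order m == 1 by rewrite -level_phi.
  split=> //; apply/(noncubeP m0 (eqP aN)) => y yN ya.
  have y1 : y != 1.
    by apply/eqP => Dy; case/eqP: (phi_neq1 a1); rewrite -ya Dy expr1n.
  have [x x1 Dy] := phi_surj y1.
  have ax : root (fibre iota g h a) x by rewrite root_fibre_phi // Dy ya.
  have /andP[x0 _] := root_fibre_nondeg a0 a1 ax.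
  by case/negP: (nox _ ax); rewrite level_phi // Dy yN.
rewrite level_phi //; split=> // x ax.
have /andP[x0 x1] := root_fibre_nondeg a0 a1 ax.
apply/negP; rewrite level_phi // => /eqP xN.
apply: (nc m0 (eqP aN) _ xN); apply/eqP.
by rewrite -root_fibre_phi.
Qed.

Lemma separable_torus m : (0 < m)%N ->
  separable_poly ('X^(torus_order m) - 1 : {poly K}).
Proof.
move=> m0; apply: separable_Xn_sub_1; rewrite -(dvdn_pcharf charK2) dvdn2.
by rewrite torus_order_odd.
Qed.

(** By phi, the points with empty fibre at level m correspond to the noncubes
    among the N-th roots of unity, N = torus_order m; there are N - N / 3 of them
    when 3 divides N. The points t and t + 1, where phi is zero or infinite,
    lie in their own fibres, and the value 1, taken at infinity, is a cube. *)
Lemma count_empty_fibre m n : (0 < m)%N -> (0 < n)%N -> (m %| n)%N ->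
  (3 * count (empty_fibre iota g h m) (points F K n) =
   if 3 %| torus_order m then 2 * torus_order m else 0)%N.
Proof.
move=> m0 n0 mn; set N := torus_order m.
have N0 : (0 < N)%N by apply: torus_order_gt0.
pose Z := zeros ('X^N - 1 : {poly K}).
have sepN : separable_poly ('X^N - 1 : {poly K}) by apply: separable_torus.
have memZ y : (y \in Z) = (y ^+ N == 1).
  by rewrite mem_zeros ?separable_poly_neq0 // rootE !hornerE subr_eq0.
have sizeZ : size Z = N by rewrite size_zeros ?separable_poly_neq0 // size_XnsubC.
have -> : count (empty_fibre iota g h m) (points F K n) = count (noncube m) Z.
  rewrite -!size_filter -(size_map phi); apply: perm_size; apply: uniq_perm.
  - rewrite map_inj_in_uniq ?filter_uniq ?(uniq_points iota) //.
    move=> x y; rewrite !mem_filter !empty_fibreE // => /andP[/and4P[_ x1 _ _] _].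
    by move=> /andP[/and4P[_ y1 _ _] _]; apply: phi_inj.
  - by rewrite filter_uniq // uniq_zeros.
  move=> y; rewrite mem_filter memZ; apply/mapP/andP => [[x]|[ncy yN]].
    by rewrite mem_filter empty_fibreE // => /andP[/and4P[_ _ xN ncx] _] ->.
  have y1 : y != 1.
    by apply: contraTneq ncy => ->; rewrite /noncube expr1n eqxx andbF.
  have [x x1 Dy] := phi_surj y1.
  have x0 : x != t.
    rewrite -phi_eq0 // Dy; apply: contraTneq yN => ->.
    by rewrite expr0n gtn_eqF // eq_sym oner_eq0.
  exists x => //; rewrite mem_filter empty_fibreE // Dy yN ncy x0 x1 /=.
  rewrite (mem_points iota) //; apply: level_dvd mn _.
  by rewrite level_phi // Dy.
rewrite /noncube -/N; case: ifP => [N3|_]; last first.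
  by rewrite (eq_count (a2 := pred0)) ?count_pred0.
rewrite (eq_count (a2 := predC (root ('X^(N %/ 3) - 1)))); last first.
  by move=> y; rewrite /= rootE !hornerE subr_eq0.
have := count_predC (root ('X^(N %/ 3) - 1)) Z; rewrite sizeZ count_root_zeros //.
  rewrite size_XnsubC ?divn_gt0 // ?(dvdn_leq N0 N3) //= => DN.
  by have := divnK N3; lia.
have -> : 'X^N - 1 = ('X^(N %/ 3)) ^+ 3 - 1 ^+ 3 :> {poly K}.
  by rewrite expr1n -exprM divnK.
by rewrite subrXX dvdp_mulIl.
Qed.

End CubeMap.

(** * The two residues of q modulo three *)

Lemma torus_orderE (F : finFieldType) m :
  (torus_order F m)%:R = #|F|%:R ^+ m - (-1) ^+ m :> int.
Proof.
rewrite /torus_order -signr_odd -natrX; case: (odd m).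
  by rewrite expr1 opprK natrD.
by rewrite expr0 natrB // card_expn_gt0.
Qed.

Lemma dvd3_torus_order1 (F : finFieldType) m :
  #|F| = 1 %[mod 3] -> (3 %| torus_order F m)%N = ~~ odd m.
Proof.
move=> q1; have : (#|F| ^ m)%N = 1 %[mod 3] by rewrite -modnXm q1 modnXm exp1n.
by rewrite /torus_order; case: odd; move: (#|F| ^ m)%N => Q; lia.
Qed.

Lemma dvd3_torus_order2 (F : finFieldType) m :
  #|F| = 2 %[mod 3] -> (3 %| torus_order F m)%N.
Proof.
move=> q2; have : (#|F| ^ m)%N = (if odd m then 2 else 1)%N %[mod 3].
  elim: m => [|m IH] //; rewrite expnS -modnMml q2 modnMml -modnMmr IH.
  by rewrite modnMmr /=; case: odd.
by rewrite /torus_order; case: odd; move: (#|F| ^ m)%N => Q; lia.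
Qed.

Lemma necklace_natE m Q : (0 < m)%N ->
  necklace m%:R Q = m%:R^-1 * (\sum_(d <- divisors m) mobius d * Q ^+ (m %/ d))%:~R.
Proof.
by move=> m0; rewrite /necklace natr_nat ltr0n m0 natrK rmorph_sum.
Qed.

Lemma necklace_notnat k Q : k \isn't a Num.nat -> necklace k Q = 0.
Proof. by rewrite /necklace => /negPf->. Qed.

(** Only the levels n / d whose torus order is divisible by 3 have points with
    empty fibre, and two thirds of the torus are such points. *)
Lemma card_transform_torus (F : finFieldType) (charF2 : 2%N \in [pchar F])
    (sigma : F) n :
  abs_trace charF2 sigma = 1 -> (0 < n)%N ->
  (3 * n * #|irr_transform_set ('X^3 + sigma *: 'X + sigma%:P)
               ('X^2 + 'X + (sigma + 1)%:P) n|)%N%:R =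
  \sum_(d <- divisors (n`_3^')%N | (3 %| torus_order F (n %/ d))%N)
     mobius d * (2%:R * (torus_order F (n %/ d))%:R) :> int.
Proof.
move=> tr_sigma n0.
have [K [iota iota_alg]] := countable_algebraic_closure F.
have [t Dt] := artin_schreier_root iota charF2 sigma.
rewrite -mulnA natrM (card_irr_transform iota_alg (monic_num sigma)
  (size_num sigma) (size_den sigma) (coprime_num_den charF2 sigma) n0).
rewrite mulr_sumr [RHS]big_mkcond big_seq [RHS]big_seq.
apply: eq_bigr => d; rewrite -dvdn_divisors ?part_gt0 // => dm.
have dn : (d %| n)%N by rewrite (dvdn_trans dm) // dvdn_part.
have nd0 : (0 < n %/ d)%N by rewrite divn_gt0 ?(dvdn_gt0 n0 dn) // dvdn_leq.
rewrite mulrCA -(natrM _ 3) (count_empty_fibre (charF2 := charF2) tr_sigma Dt) //.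
  by case: ifP; rewrite ?mulr0 // natrM.
exact: dvdn_div.
Qed.

Lemma rat_of_tripled_sum (n N : nat) (S : int) : (0 < n)%N ->
  (3 * n * N)%N%:R = 2%:R * S -> N%:R = 2%:R * S%:~R / (3 * n)%:R :> rat.
Proof.
move=> n0 E; have n3 : (3 * n)%:R != 0 :> rat by rewrite pnatr_eq0 muln_eq0 -lt0n.
apply: (canRL (mulfK n3)); rewrite -natrM mulnC.
transitivity (((3 * n * N)%N%:R : int)%:~R : rat); first by rewrite rmorph_nat.
by rewrite E rmorphM rmorph_nat.
Qed.

Theorem theorem19 (F : finFieldType) (charF2 : 2%N \in [pchar F]) (sigma : F)
    (tr_sigma : abs_trace charF2 sigma = 1) (n : nat) (n_gt1 : (1 < n)%N) :
  let q : int := #|F|%:Z in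
  let n3 : nat := (n`_3)%N in
  let N : rat :=
    #|irr_transform_set ('X^3 + sigma *: 'X + sigma%:P)
        ('X^2 + 'X + (sigma + 1)%:P) n|%:R in
  ((q = 1 %[mod 3])%Z ->
     N = 1 / (3 * n3)%:R *
           (necklace (n%:R / (2 * n3)%:R) (q ^+ (2 * n3))
            - necklace (n%:R / (2 * n3)%:R) 1)) /\
  ((q = -1 %[mod 3])%Z ->
     N = 2 / (3 * n3)%:R *
           (necklace (n%:R / n3%:R) (q ^+ n3)
            - necklace (n%:R / n3%:R) (-1))).
Proof.
have n0 : (0 < n)%N by apply: ltnW.
have := card_transform_torus tr_sigma n0; move: #|irr_transform_set _ _ _| => N0 Nsum.
move=> q n3 N; set m := (n`_3^')%N in Nsum.
have Dn : n = (n3 * m)%N by rewrite partnC.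
have n30 : (0 < n3)%N by apply: part_gt0.
have m0 : (0 < m)%N by apply: part_gt0.
have odd_n3 : odd n3 by rewrite /n3 p_part oddX orbT.
have n3F : n3%:R != 0 :> rat by rewrite pnatr_eq0 -lt0n.
have mF : m%:R != 0 :> rat by rewrite pnatr_eq0 -lt0n.
have divd d : (d %| m)%N -> (n %/ d = n3 * (m %/ d))%N.
  by move=> dm; rewrite Dn muln_divA.
split=> qmod.
  have q1 : #|F| = 1 %[mod 3].
    by move: qmod; rewrite /q; move: #|F| => Q; lia.
  case: (boolP (odd n)) => odd_n.
    (* For odd n all n / d are odd, so no torus order is divisible by 3. *)
    have -> : N = 0.
      have /eqP := Nsum; rewrite big_seq_cond big1; last first.
        move=> d /andP[]; rewrite -dvdn_divisors // => dm.
        rewrite dvd3_torus_order1 // => /negP[].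
        have dn : (d %| n)%N by rewrite (dvdn_trans dm) // dvdn_part.
        by move: odd_n; rewrite -{1}(divnK dn) oddM => /andP[].
      rewrite pnatr_eq0 !muln_eq0 /= (gtn_eqF n0) /= => /eqP Nz.
      by rewrite /N Nz.
    have notnat : (n%:R / (2 * n3)%:R : rat) \isn't a Num.nat.
      apply/negP => /natrP[k Dk]; case/negP: (odd_n).
      have -> : n = (2 * n3 * k)%N; last by rewrite -mulnA oddM.
      apply/eqP; rewrite -(eqr_nat rat) [X in _ == X]natrM -Dk mulrC mulfVK //.
      by rewrite natrM mulf_neq0.
    by rewrite !necklace_notnat // subrr mulr0.
  (* The terms with n / d odd vanish, which leaves the divisors d of m / 2. *)
  pose m2 := m./2.
  have Dm : m = (2 * m2)%N.
    rewrite mul2n even_halfK //; move: odd_n.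
    by rewrite {1}Dn oddM odd_n3.
  have m20 : (0 < m2)%N by move: m0; rewrite Dm muln_gt0 => /andP[].
  have m2F : m2%:R != 0 :> rat by rewrite pnatr_eq0 -lt0n.
  have -> : n%:R / (2 * n3)%:R = m2%:R :> rat.
    by rewrite Dn Dm !natrM; field; rewrite n3F.
  rewrite !necklace_natE // -mulrBr -rmorphB -sumrB.
  have : (3 * n * N0)%N%:R = 2%:R * \sum_(d <- divisors m2)
      (mobius d * (q ^+ (2 * n3)) ^+ (m2 %/ d) - mobius d * 1 ^+ (m2 %/ d)) :> int.
    have m2m : (m2 %| m)%N by rewrite Dm dvdn_mull.
    rewrite Nsum -(big_divisors_dvd _ m0 m2m) mulr_sumr big_seq_cond [RHS]big_seq_cond.
    have dvd_m2 d : (d %| m)%N -> (3 %| torus_order F (n %/ d))%N = (d %| m2)%N.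
      move=> dm; rewrite dvd3_torus_order1 // divd // oddM odd_n3 /= -dvdn2.
      by rewrite dvdn_divRL // {1}Dm dvdn_pmul2l.
    apply: eq_big => [d|d /andP[]].
      by case: (boolP (d \in divisors m)) => //=; rewrite -dvdn_divisors // => /dvd_m2.
    rewrite -dvdn_divisors // => dm; rewrite dvd_m2 // => dm2.
    have nd : (n %/ d = 2 * n3 * (m2 %/ d))%N.
      by rewrite divd // Dm -muln_divA // mulnCA mulnA.
    rewrite torus_orderE -exprM expr1n -nd.
    rewrite -signr_odd nd -mulnA oddM /= expr0 /q -(natz #|F|).
    ring.
  rewrite {}/N; move/(rat_of_tripled_sum n0)->; rewrite Dn Dm /=.
  set S := (_%:~R); rewrite !natrM; by field; rewrite n3F m2F.
have q2 : #|F| = 2 %[mod 3].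
  by move: qmod; rewrite /q; move: #|F| => Q; lia.
have -> : n%:R / n3%:R = m%:R :> rat by rewrite Dn natrM; field.
rewrite !necklace_natE // -mulrBr -rmorphB -sumrB.
have : (3 * n * N0)%N%:R = 2%:R * \sum_(d <- divisors m)
    (mobius d * (q ^+ n3) ^+ (m %/ d) - mobius d * (-1) ^+ (m %/ d)) :> int.
  rewrite Nsum mulr_sumr big_seq_cond [RHS]big_seq.
  apply: eq_big => [d|d /andP[]]; first by rewrite dvd3_torus_order2 // andbT.
  rewrite -dvdn_divisors // => dm _; rewrite torus_orderE -exprM -divd //.
  (* The signs agree because n / d = n3 (m / d) with n3 odd. *)
  rewrite -[(-1) ^+ (n %/ d)]signr_odd divd // oddM odd_n3 /= signr_odd.
  by rewrite /q -(natz #|F|); ring.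
rewrite {}/N; move/(rat_of_tripled_sum n0)->; rewrite Dn /=.
set S := (_%:~R); rewrite !natrM; by field; rewrite n3F mF.
Qed.
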